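(* Let $n\ge 3$ and let $\mathscr{R}_n\subset\mathbb{Z}_+^{n(n-1)}$ be the monoid of runner-up consistent score sheets of $n$ teams (defined in the context). Define two sets of score sheets: $A_n$ is the set of score sheets $(g_{ij})$ for which there exists $r\in\mathbb{Z}$ with $1\le r\le n$ such that: (1) for each $i\in\{1,\dots,r\}$ there is an index $j_i\in\{2,\dots,n\}\setminus\{i\}$ with $g_{i j_i}=1$ and $g_{ij}=0$ for all $j\neq j_i$ (i.e. each of $T_1,\dots,T_r$ has scored exactly one goal in total, against a team different from $T_1$); (2) $g_{ij}=0$ for all $i\in\{r+1,\dots,n\}$ and all $j\ne i$. $B_n$ is the set of score sheets $(g_{ij})$ for which there exist $r,q\in\mathbb{Z}$ with $1\le r<q\le n$ such that: (1) for each $i\in\{1,\dots,r\}$ there is $j_i\in\{2,\dots,n\}\setminus\{i\}$ with $g_{ij_i}=1$ and $g_{ij}=0$ for all $j\ne j_i$; (2) for each $i\in\{r+1,\dots,q\}$, $g_{i1}=1$ and $g_{ij}=0$ for all $j\notin\{1,i\}$ (each of $T_{r+1},\dots,T_q$ has scored exactly one goal, against $T_1$); (3) $g_{ij}=0$ for all $i\in\{q+1,\dots,n\}$ and all $j\neq i$. Then the Hilbert basis of $\mathscr{R}_n$ is $A_n\cup B_n$. Moreover, the Hilbert basis of $\mathscr{R}_n$ equals the set of extreme integral generators of the cone $C_n=\mathbb{R}_+\mathscr{R}_n$, and the polytope whose vertices are the Hilbert basis elements is compressed. Furthermore \[ \# A_n=(n-1)\sum_{i=0}^{n-1}(n-2)^i,\qquad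 \# B_n=(n-1)\sum_{i=0}^{n-1}(n-2)^i(n-i-1), \] and \[ \#\operatorname{HB}(\mathscr{R}_n)=\#(A_n\cup B_n)=(n-1)\sum_{i=0}^{n-1}(n-2)^i(n-i)=(n-1)\sum_{k=0}^{n-1}\sum_{i=0}^{k}(n-2)^i. \]
   Context: A score sheet of a round-robin tournament between teams $T_1,\dots,T_n$ is a family $(g_{ij})_{1\le i\ne j\le n}$ of nonnegative integers ($g_{ij}$ = number of goals $T_i$ scored against $T_j$), viewed as an element of $\mathbb{Z}_+^{n(n-1)}$; score sheets are added entrywise. Let $g_i=\sum_{j\ne i}g_{ij}$. A score sheet is ordered if $g_1\ge g_2\ge\cdots\ge g_n$. Let $\bar g_i=g_i-g_{i1}$ for $i=2,\dots,n$ (goals of $T_i$ not scored against $T_1$). An ordered score sheet is runner-up consistent if additionally $\bar g_2\ge\bar g_3\ge\cdots\ge\bar g_n$ (i.e., deleting the first row and column preserves the ordering). $\mathscr{R}_n$ is the monoid of runner-up consistent score sheets. The Hilbert basis $\operatorname{HB}(M)$ of an affine monoid $M$ is its unique minimal generating set (its irreducible elements). Extreme integral generators of a pointed rational cone are the primitive integral vectors spanning its extreme rays. A lattice polytope $P$ is compressed if every pulling triangulation of $P$ (using its lattice points) is unimodular with respect to the lattice $\mathbb{Z}^{n(n-1)}\cap\operatorname{aff}(P)$. *)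

(* Defs.v *)
From mathcomp Require Import all_boot all_order all_algebra.
From mathcomp Require Import classical_sets cardinality.

Set Implicit Arguments.
Unset Strict Implicit.
Unset Printing Implicit Defensive.

Import Order.TTheory GRing.Theory Num.Theory.

Local Open Scope classical_set_scope.
Local Open Scope ring_scope.

Definition generated_by (V : nmodType) (G : set V) : set V :=
  [set x | exists s : seq V, [set` s] `<=` G /\ x = \sum_(y <- s) y].

Definition minimal_generating_set (V : nmodType) (M G : set V) : Prop :=
  generated_by G = M /\
  forall G' : set V, G' `<=` G -> generated_by G' = M -> G' = G.

(* Irreducibility is stated for monoids whose only invertible element is 0. *)
Definition irreducible_in (V : nmodType) (M : set V) (x : V) : Prop :=
  [/\ M x, x != 0 &
      forall y z, M y -> M z -> x = y + z -> y = 0 \/ z = 0].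

Definition hilbert_basis (V : nmodType) (M : set V) : set V :=
  [set x | irreducible_in M x].

Definition cone (R : realFieldType) (V : vectType R) (S : set V) : set V :=
  [set x | exists (s : seq V) (c : V -> R),
     [/\ [set` s] `<=` S, forall v, 0 <= c v & x = \sum_(v <- s) c v *: v]].

Definition conv (R : realFieldType) (V : vectType R) (S : set V) : set V :=
  [set x | exists (s : seq V) (c : V -> R),
     [/\ [set` s] `<=` S, forall v, 0 <= c v, \sum_(v <- s) c v = 1
       & x = \sum_(v <- s) c v *: v]].

Definition aff (R : realFieldType) (V : vectType R) (S : set V) : set V :=
  [set x | exists (s : seq V) (c : V -> R),
     [/\ [set` s] `<=` S, \sum_(v <- s) c v = 1
       & x = \sum_(v <- s) c v *: v]].

Definition affinely_independent (R : realFieldType) (V : vectType R)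
    (s : seq V) : bool :=
  if s is v :: t then free [seq w - v | w <- t] else true.

Definition has_dim (R : realFieldType) (V : vectType R)
    (S : set V) (d : nat) : Prop :=
  exists s : seq V, [/\ size s = d.+1, affinely_independent s,
                        [set` s] `<=` S & S `<=` aff [set` s]].

(* Taking [l = 0] gives [P] itself ([b = 0]) and the empty face ([b > 0]). *)
Definition face (R : realFieldType) (V : vectType R) (P F : set V) : Prop :=
  exists (l : {scalar V}) (b : R),
    (forall x, P x -> l x <= b) /\ F = P `&` [set x | l x = b].

(* The empty facet of a point is not covered, as dimensions are natural
   numbers here. *)
Definition facet (R : realFieldType) (V : vectType R) (P F : set V) : Prop :=
  face P F /\ exists d : nat, has_dim P d.+1 /\ has_dim F d.

Definition vertices (R : realFieldType) (V : vectType R) (P : set V) : set V :=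
  [set v | face P [set v]].

Definition extreme_ray (R : realFieldType) (V : vectType R)
    (C F : set V) : Prop :=
  face C F /\ has_dim F 1.

(* [R^o] rather than [R] makes the function space a vector space. *)
Notation space R I := {ffun I -> R^o}.

Definition embed (R : realFieldType) (I : finType) (z : {ffun I -> int}) :
    space R I :=
  [ffun i => (z i)%:~R].

Definition lattice (R : realFieldType) (I : finType) : set (space R I) :=
  range (@embed R I).

Arguments lattice : clear implicits.

Definition primitive (I : finType) (z : {ffun I -> int}) : Prop :=
  forall d : int, (forall i, (d %| z i)%Z) -> (d %| 1)%Z.

Definition extreme_integral_generators (R : realFieldType) (I : finType)
    (C : set (space R I)) : set {ffun I -> int} :=
  [set z | primitive z /\ extreme_ray C (cone [set embed R z])].

Definition lattice_polytope (R : realFieldType) (I : finType)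
    (P : set (space R I)) : Prop :=
  exists s : seq (space R I), [set` s] `<=` lattice R I /\ P = conv [set` s].

(* [pulling_simplex P s u]: if [s] lists the lattice points of [P] in the
   order in which they are pulled, then [u] lists the vertices of a maximal
   simplex of the resulting pulling triangulation of [P]. This triangulation
   consists of the joins of the first point [v] with the simplices of the
   pulling triangulations (for the induced order) of the facets of [P] that do
   not contain [v]. *)
Inductive pulling_simplex (R : realFieldType) (I : finType) :
    set (space R I) -> seq (space R I) -> seq (space R I) -> Prop :=
  | pulling_point v : pulling_simplex [set v] [:: v] [:: v]
  | pulling_join P v s F u :
      facet P F -> ~ F v ->
      pulling_simplex F [seq x <- s | x \in F] u ->
      pulling_simplex P (v :: s) (v :: u).

(* The points of [u] form an affine basis, over the integers, of
   [lattice `&` aff P]. *)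
Definition unimodular (R : realFieldType) (I : finType)
    (P : set (space R I)) (u : seq (space R I)) : Prop :=
  affinely_independent u /\
  forall x, (lattice R I `&` aff P) x ->
    exists c : space R I -> int,
      \sum_(v <- u) c v = 1 /\ x = \sum_(v <- u) (c v)%:~R *: v.

Definition compressed (R : realFieldType) (I : finType)
    (P : set (space R I)) : Prop :=
  lattice_polytope P /\
  forall s : seq (space R I), uniq s -> [set` s] = lattice R I `&` P ->
  forall u, pulling_simplex P s u -> unimodular P u.

(* Teams are numbered from 0: the team T_k is the element k - 1 of ['I_n]. *)
Notation pairing n := {p : 'I_n * 'I_n | p.1 != p.2}.
Notation sheet n := {ffun pairing n -> int}.

(* By convention a team scores no goal against itself. *)
Definition goals (n : nat) (g : sheet n) (i j : 'I_n) : int :=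
  if insub (i, j) is Some p then g p else 0.

Definition score_sheet (n : nat) (g : sheet n) : Prop := forall p, 0 <= g p.

Definition total_goals (n : nat) (g : sheet n) (i : 'I_n) : int :=
  \sum_(j : 'I_n | j != i) goals g i j.

(* The sum has one term, the goals of [i] against the first team. *)
Definition goals_not_against_first (n : nat) (g : sheet n) (i : 'I_n) : int :=
  total_goals g i - \sum_(j : 'I_n | j == 0%N :> nat) goals g i j.

Definition ordered (n : nat) (g : sheet n) : Prop :=
  forall i j : 'I_n, (i <= j)%N -> total_goals g j <= total_goals g i.

Definition runner_up_ordered (n : nat) (g : sheet n) : Prop :=
  forall i j : 'I_n, (0 < i)%N -> (i <= j)%N ->
    goals_not_against_first g j <= goals_not_against_first g i.

Definition runner_up_consistent (n : nat) : set (sheet n) :=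
  [set g | [/\ score_sheet g, ordered g & runner_up_ordered g]].

Definition one_goal_not_first (n : nat) (g : sheet n) (i : 'I_n) : Prop :=
  exists j : 'I_n, [/\ j != 0%N :> nat, j != i, goals g i j = 1
                     & forall k, k != j -> goals g i k = 0].

Definition one_goal_first (n : nat) (g : sheet n) (i : 'I_n) : Prop :=
  forall j : 'I_n, j != i -> goals g i j = (j == 0%N :> nat)%:R.

Definition no_goal (n : nat) (g : sheet n) (i : 'I_n) : Prop :=
  forall j : 'I_n, j != i -> goals g i j = 0.

Definition sheets_A (n : nat) : set (sheet n) :=
  [set g | score_sheet g /\ exists r : nat,
    [/\ (1 <= r <= n)%N,
        forall i : 'I_n, (i < r)%N -> one_goal_not_first g i
      & forall i : 'I_n, (r <= i)%N -> no_goal g i]].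

Definition sheets_B (n : nat) : set (sheet n) :=
  [set g | score_sheet g /\ exists r q : nat,
    [/\ [&& 1 <= r, r < q & q <= n]%N,
        forall i : 'I_n, (i < r)%N -> one_goal_not_first g i,
        forall i : 'I_n, (r <= i < q)%N -> one_goal_first g i
      & forall i : 'I_n, (q <= i)%N -> no_goal g i]].

Arguments runner_up_consistent : clear implicits.
Arguments sheets_A : clear implicits.
Arguments sheets_B : clear implicits.

(* Main.v *)
Require Import Defs.
From HB Require Import structures.
From mathcomp Require Import all_boot all_order all_algebra.
From mathcomp Require Import classical_sets cardinality reals.
From mathcomp Require Import boolp zify ring lra.

Set Implicit Arguments.
Unset Strict Implicit.
Unset Printing Implicit Defensive.

Import Order.TTheory GRing.Theory Num.Theory.

Local Open Scope classical_set_scope.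
Local Open Scope card_scope.
Local Open Scope ring_scope.

(* Since [g_1 >= g_2 >= gbar_2], the numbers [gbar_1 := g_1, gbar_2, ...,
   gbar_n] and [g_1, ..., g_n] both decrease along the teams.  Hence a nonzero
   [x] in the monoid, or in its cone, has a sheet [e] in [A_n] or [B_n] below
   it: [T_i] scores one goal off [T_1] if [gbar_i > 0], one goal against [T_1]
   if [gbar_i = 0 < g_i], and none otherwise, always using a positive entry of
   [x].  Every defining inequality ("slack") takes the values 0 and 1 on [e],
   and vanishes on [e] where it vanishes on [x]; so [e] can be subtracted from
   [x], once in the monoid and with a maximal coefficient in the cone.  As
   [g_1 = 1] on these sheets, they are the irreducible elements, and the
   polytope is the section [g_1 = 1] of the cone.  Each of them spans the face
   on which its vanishing slacks vanish.
   The 0/1 slacks also make the polytope compressed: a facet [F] avoiding a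
   lattice point [v] lies in a hyperplane [h = 0] with [h v = 1] for some
   integral slack [h], so subtracting [h x] times [v] from a lattice point [x]
   lands in the span of [F], and one proceeds by induction. *)

(** * Faces and pulling simplices of a polyhedron in a hyperplane *)

Section Hyperplane.
Variables (R : realFieldType) (V : vectType R) (lam : {scalar V}).

(** [lam] kills the differences [w - v] but not [v], so these differences are free exactly when they
    are free together with [v]. The enlarged family has the span and the size of [v :: t]. *)
Lemma affinely_independentE (s : seq V) :
  (forall x, x \in s -> lam x = 1) -> affinely_independent s = free s.
Proof.
case: s => [|v t] lam1 /=; first by rewrite nil_free.
have lamv : lam v = 1 by apply: lam1; rewrite mem_head.
have vt0 : v \notin <<[seq w - v | w <- t]>>%VS.
  apply/negP => vt.
  have := lamv; rewrite [in lam v](@coord_span _ _ _ (in_tuple _) _ vt) linear_sum /= big1.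
    by move/eqP; rewrite eq_sym oner_eq0.
  move=> i _; rewrite linearZ /=.
  have /mapP[w wt ->] := mem_nth 0 (ltn_ord i).
  by rewrite linearB /= lamv lam1 ?subrr ?mulr0// inE wt orbT.
have eqs : <<v :: t>>%VS = <<v :: [seq w - v | w <- t]>>%VS.
  apply/eqP; rewrite eqEsubv; apply/andP; split; apply/span_subvP => w.
    rewrite inE => /predU1P[->|wt]; first by rewrite memv_span ?mem_head.
    rewrite -(subrK v w) memvD ?memv_span ?mem_head//.
    by rewrite inE; apply/orP; right; apply/mapP; exists w.
  rewrite inE => /predU1P[->|/mapP[u ut ->]]; first by rewrite memv_span ?mem_head.
  by rewrite memvB ?memv_span ?mem_head// inE ut orbT.
transitivity (free (v :: [seq w - v | w <- t])).
  by rewrite free_cons vt0.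
by rewrite /free eqs /= size_map.
Qed.

Lemma aff_lin (S : set V) x :
  (forall y, S y -> lam y = 1) -> aff S x -> lam x = 1.
Proof.
move=> S1 [s [c [sS c1 ->]]]; rewrite linear_sum -[RHS]c1 /=.
apply: eq_big_seq => v vs; rewrite linearZ /= S1 ?mulr1//; exact: sS.
Qed.

End Hyperplane.

Lemma aff_span (R : realFieldType) (V : vectType R) (s : seq V) x :
  aff [set` s] x -> x \in <<s>>%VS.
Proof.
move=> [t [c [ts _ ->]]]; rewrite big_seq memv_suml// => v vt.
by rewrite memvZ// memv_span//; exact: ts.
Qed.

Section Polyhedron.
Variables (R : realFieldType) (V : vectType R) (lam : {scalar V}).
Variables (K : finType) (h : K -> {scalar V}).

(** Faces are encoded by the set [K0] of inequalities turned into equations; [set0] gives the whole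
    polyhedron. *)
Definition section_face (K0 : set K) : set V :=
  [set x | [/\ lam x = 1, forall k, 0 <= h k x & forall k, K0 k -> h k x = 0]].

Lemma scalar_ray (f : {scalar V}) p x (e : R) :
  f (p + e *: (p - x)) = f p + e * (f p - f x).
Proof. by rewrite linearD linearZ linearB. Qed.

(** Slacks vanishing at both points vanish on the whole line. The finitely many others are positive
    at [p], so they survive a small enough step beyond [p], away from [x]. *)
Lemma ray_slack_ge0 (p x : V) (D : set K) :
  (forall k, ~ D k -> 0 < h k p) -> (forall k, D k -> h k p = 0 /\ h k x = 0) ->
  exists2 e : R, 0 < e & forall k, 0 <= h k (p + e *: (p - x)).
Proof.
move=> pos zero.
have [e e0 He] : exists2 e : R, 0 < e &
    forall k, k \in enum K -> 0 <= h k (p + e *: (p - x)).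
  elim: (enum K) => [|k s [e e0 IH]]; first by exists 1.
  (* Each slack is affine along the ray and nonnegative at the parameters 0 and [e], hence also at
     [d]. *)
  have step (d : R) : 0 < d -> d <= e ->
      (forall k', k' \in s -> 0 <= h k' (p + d *: (p - x))).
    move=> d0 de k' k's; have := IH k' k's.
    rewrite !scalar_ray => Hk.
    have [Dk|/pos pk] := pselect (D k').
      by have [-> ->] := zero _ Dk; rewrite subrr mulr0 addr0.
    by nra.
  have [Dk|/pos pk] := pselect (D k).
    exists e => // k'; rewrite inE => /predU1P[->|/IH//].
    rewrite scalar_ray.
    by have [-> ->] := zero _ Dk; rewrite subrr mulr0 addr0.
  (* This bound gives [d * h k x <= h k p]; the summand 1 keeps the denominator positive. *)
  pose d := Num.min e (h k p / (1 + `|h k x|)).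
  have x0 : 0 < 1 + `|h k x| by rewrite ltr_pwDl.
  have d0 : 0 < d by rewrite lt_min e0 divr_gt0.
  exists d => // k'; rewrite inE => /predU1P[->|]; last first.
    by apply: step => //; rewrite ge_min lexx.
  rewrite scalar_ray.
  have : d <= h k p / (1 + `|h k x|) by rewrite ge_min lexx orbT.
  rewrite ler_pdivlMr// => dh.
  have := ler_norm (h k x); nra.
by exists e => // k; apply: He; rewrite mem_enum.
Qed.

(* The barycentre [p] of an affine basis of [F] is interior to [F]: [F] is cut
   out by the inequalities tight at [p]. *)
Lemma facet_section_face (K0 : set K) F :
  facet (section_face K0) F -> exists K1 : set K, F = section_face K1.
Proof.
move=> [[l [b [lb ->]]] [d [_ [s [ss _ sF Fs]]]]].
pose p := (d.+1%:R)^-1 *: \sum_(v <- s) v.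
have d0 : 0 < (d.+1%:R : R) by rewrite ltr0n.
have lp (f : {scalar V}) : f p = (d.+1%:R)^-1 * \sum_(v <- s) f v.
  by rewrite /p linearZ linear_sum.
have mean (f : {scalar V}) a : (forall v, v \in s -> f v = a) -> f p = a.
  move=> fa; rewrite lp (eq_big_seq (fun=> a))// big_const_seq count_predT ss.
  by rewrite iter_addr addr0 -[a *+ _]mulr_natl mulKf// gt_eqF.
have sQ v : v \in s -> section_face K0 v by move=> /sF[].
have Qp : section_face K0 p.
  split; first by apply: mean => v /sQ[].
    move=> k; rewrite lp mulr_ge0 ?invr_ge0 ?(ltW d0)// big_seq sumr_ge0// => v.
    by move=> /sQ[].
  by move=> k K0k; apply: mean => v /sQ[_ _]; apply.
have lpb : l p = b by apply: mean => v /sF[].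
have tight k v : h k p = 0 -> v \in s -> h k v = 0.
  move=> /eqP; rewrite lp mulf_eq0 invr_eq0 (gt_eqF d0) /= => kp vs.
  have : \sum_(v <- s | v \in s) h k v == 0 by rewrite -big_seq.
  rewrite psumr_eq0 => [|w /sQ[]//].
  by move=> /allP /(_ _ vs) /implyP /(_ vs) /eqP.
exists [set k | h k p = 0]; apply/seteqP; split => x.
  move=> [[x1 xpos x0] xb]; split=> // k /= kp.
  have [t [c [ts _ ->]]] : aff [set` s] x by apply: Fs.
  rewrite linear_sum big_seq big1// => v vt.
  by rewrite linearZ /= (tight k v)// ?mulr0//; exact: ts.
move=> [x1 xpos x0]; have Qx : section_face K0 x.
  by split=> // k K0k; apply: x0; case: Qp => _ _; apply.
split=> //.
(* The segment from [x] to [p] can be prolonged beyond [p] inside the polyhedron. If [l x < b], then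
   [l] would exceed [b] there, because [l p = b]. *)
have [e e0 He] : exists2 e : R, 0 < e & forall k, 0 <= h k (p + e *: (p - x)).
  apply: (@ray_slack_ge0 p x [set k | h k p = 0]) => k /=.
    by move=> /eqP kp; rewrite lt_neqAle eq_sym kp; have [_ ->] := Qp.
  by move=> kp; split=> //; exact: x0.
have : l (p + e *: (p - x)) <= b.
  apply: lb; split=> // [|k K0k].
    by rewrite scalar_ray x1; case: Qp => -> _ _; ring.
  rewrite scalar_ray; have [_ _ ->//] := Qp; have [_ _ ->//] := Qx.
  by rewrite subrr mulr0 addr0.
rewrite scalar_ray lpb => Hb.
by apply/eqP; rewrite eq_le lb//=; nra.
Qed.

Lemma conv_section_face (K0 : set K) (S : set V) x :
  S `<=` section_face K0 -> conv S x -> section_face K0 x.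
Proof.
move=> SQ [s [c [sS c0 c1 ->]]].
have sQ v : v \in s -> section_face K0 v by move=> vs; apply/SQ/sS.
split=> [|k|k K0k]; rewrite linear_sum.
- rewrite -[RHS]c1; apply: eq_big_seq => v /sQ[v1 _ _].
  by rewrite linearZ /= v1 mulr1.
- by rewrite big_seq sumr_ge0// => v /sQ[_ v0 _]; rewrite linearZ /= mulr_ge0.
by rewrite big_seq big1// => v /sQ[_ _ v0]; rewrite linearZ /= v0// mulr0.
Qed.

End Polyhedron.

(** * Pulling triangulations of a polytope with 0/1 slacks *)

Section Pulling.
Variables (R : realFieldType) (I : finType).
Variables (lam : {scalar (Defs.space R I)}) (K : finType) (h : K -> {scalar (Defs.space R I)}).
Hypothesis lam_int : forall x, lattice R I x -> exists m : int, lam x = m%:~R.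
Hypothesis h_int : forall k x, lattice R I x -> exists m : int, h k x = m%:~R.
Hypothesis h_01 : forall k x, lattice R I x -> section_face lam h set0 x ->
  h k x = 0 \/ h k x = 1.

Lemma latticeBZ x v (m : int) :
  lattice R I x -> lattice R I v -> lattice R I (x - m%:~R *: v).
Proof.
move=> [y _ <-] [w _ <-]; exists [ffun i => y i - m * w i] => //.
by apply/ffunP => i; rewrite !ffunE /= rmorphB rmorphM.
Qed.

Lemma section_face_sub K0 : section_face lam h K0 `<=` section_face lam h set0.
Proof. by move=> x [x1 xpos _]. Qed.

(* Affine conditions are stated linearly, because [lam = 1] on [P]: integer
   coefficients expressing a point where [lam = 1] add up to 1. *)
Lemma pulling_simplex_basis P s u : pulling_simplex P s u ->
  forall K0, P = section_face lam h K0 -> [set` s] `<=` lattice R I `&` P ->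
  [/\ [set` u] `<=` P, free u &
    forall x t, lattice R I x -> [set` t] `<=` P -> x \in <<t>>%VS ->
      exists c : Defs.space R I -> int, x = \sum_(v <- u) (c v)%:~R *: v].
Proof.
elim=> {P s u} [v|P v s F u PF Fv _ IH] K0 PE sP.
  have [Lv Pv] : (lattice R I `&` [set v]) v by apply: sP; exact: mem_head.
  have v1 : lam v = 1 by move: Pv; rewrite PE => -[].
  split=> [w /=||x t Lx tv xt]; first by rewrite inE => /eqP.
    by rewrite seq1_free; apply: contra_eq_neq v1 => ->; rewrite linear0 eq_sym oner_neq0.
  have : x \in <[v]>%VS.
    apply: subvP xt; apply/span_subvP => w wt.
    by rewrite (tv w wt) memv_line.
  move=> /vlineP[a xE]; have [m Hm] := lam_int Lx.
  exists (fun=> m); rewrite big_seq1 -Hm xE linearZ /= v1.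
  by rewrite mulr1.
have [K1 FE] : exists K1, F = section_face lam h K1.
  by apply: (@facet_section_face _ _ lam _ h K0); rewrite -PE.
have sub : F `<=` P by case: PF => -[l [b [_ ->]]] _ x [].
have [Lv Pv] : (lattice R I `&` P) v by apply: sP; exact: mem_head.
have Pv0 : section_face lam h set0 v by move: Pv; rewrite PE; exact: section_face_sub.
(* As [v] is not in [F], one of the equations of [F] fails at [v]; at a lattice point a nonzero
   slack equals 1. *)
have [k K1k kv] : exists2 k, K1 k & h k v = 1.
  apply: contrapT => /forall2NP nk; apply: Fv; rewrite FE; split; try by case: Pv0.
  by move=> k K1k; have [//|kv1] := h_01 k Lv Pv0; case: (nk k).
have kF x : F x -> h k x = 0 by rewrite FE => -[_ _]; apply.
have [uF uf uZ] : [/\ [set` u] `<=` F, free u &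
    forall x t, lattice R I x -> [set` t] `<=` F -> x \in <<t>>%VS ->
      exists c : Defs.space R I -> int, x = \sum_(v <- u) (c v)%:~R *: v].
  apply: (IH K1) => // x /=; rewrite mem_filter => /andP[/set_mem Fx xs].
  by split=> //; have [] := sP x; rewrite //= inE xs orbT.
have kspan t x : [set` t] `<=` F -> x \in <<t>>%VS -> h k x = 0.
  move=> tF /(@coord_span _ _ _ (in_tuple _)) ->; rewrite linear_sum big1// => i _.
  by rewrite linearZ /= kF ?mulr0//; apply: tF; exact: mem_nth.
have vspan t : [set` t] `<=` F -> v \notin <<t>>%VS.
  by move=> tF; apply/negP => /(kspan _ _ tF)/eqP; rewrite kv oner_eq0.
split=> [w /=||x t Lx tP xt].
- by rewrite inE => /predU1P[->//|/uF/sub].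
- by rewrite free_cons vspan.
have P1 w : P w -> lam w = 1 by rewrite PE => -[].
have [d [[s1 [s1d s1i s1P Ps1]] [s2 [s2d s2i s2F _]]]] := PF.2.
have vs2P w : w \in v :: s2 -> P w by rewrite inE => /predU1P[->//|/s2F/sub].
have s1f : free s1 by rewrite -(affinely_independentE (lam:=lam))// => w /s1P/P1.
have s2f : free s2 by rewrite -(affinely_independentE (lam:=lam))// => w /s2F/sub/P1.
(* [F] has one dimension less than [P] and its span misses [v], so both free families have the same
   size and one inclusion suffices. *)
have span12 : <<v :: s2>>%VS = <<s1>>%VS.
  apply/eqP; rewrite eqEdim; apply/andP; split.
    by apply/span_subvP => w /vs2P/Ps1/aff_span.
  have := s1f; rewrite /free => /eqP ->.
  have : free (v :: s2) by rewrite free_cons vspan.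
  by rewrite /free => /eqP ->; rewrite /= s1d s2d.
have : x \in <<v :: s2>>%VS.
  by rewrite span12; apply: subvP xt; apply/span_subvP => w /tP/Ps1/aff_span.
rewrite span_cons => /memv_addP[_ /vlineP[a ->] [y ys2 xE]].
(* [h k] is 1 at [v] and 0 on the span of [F], so it reads off the coefficient of [v], which is
   therefore an integer. *)
have [m Hm] := h_int k Lx.
have am : a = m%:~R.
  by rewrite -Hm xE linearD linearZ /= kv mulr1 (kspan s2)// addr0.
have yE : y = x - m%:~R *: v by rewrite xE am addrC addKr.
have [c cE] : exists c : Defs.space R I -> int, y = \sum_(w <- u) (c w)%:~R *: w.
  by apply: (uZ y s2) => //; rewrite yE; exact: latticeBZ.
(* [u] lies in [F], so [v] does not occur in it and its coefficient can be prescribed. *)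
exists (fun w => if w == v then m else c w).
rewrite big_cons eqxx xE am cE; congr (_ + _).
apply: eq_big_seq => w wu; case: eqP => // wv; exfalso.
by apply: Fv; rewrite -wv; exact: uF.
Qed.

Lemma section_face_compressed :
  lattice_polytope (section_face lam h set0) -> compressed (section_face lam h set0).
Proof.
move=> latP; split=> // s _ sE u /pulling_simplex_basis /(_ set0 erefl).
rewrite sE => /(_ (fun _ => id))[uP uf uZ].
have u1 w : w \in u -> lam w = 1 by move=> /uP[].
split; first by rewrite (affinely_independentE u1).
move=> x [Lx [t [d [tP d1 xE]]]].
have x1 : lam x = 1.
  by apply: (@aff_lin _ _ lam [set` t]); [move=> y /tP[]|exists t, d; split].
have [c cE] : exists c : Defs.space R I -> int, x = \sum_(v <- u) (c v)%:~R *: v.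
  apply: (uZ x t) => //; apply: aff_span; by exists t, d; split.
exists c; split=> //; apply: (@intr_inj R).
rewrite rmorph_sum /= -[RHS]x1 cE linear_sum.
by apply: eq_big_seq => v vu; rewrite linearZ /= u1 ?mulr1.
Qed.

End Pulling.

(** Subtract from [x] the multiple of [e] given by the least [h k x] over the [k] with [h k e = 1].
    All slacks stay nonnegative, none becomes positive and the minimising one becomes 0, so the
    number of positive slacks drops. *)
Lemma cone_decomposition (R : realFieldType) (V : vectType R) (K : finType)
    (h : K -> {scalar V}) (E : seq V) :
  uniq E ->
  (forall x, (forall k, 0 <= h k x) -> x != 0 -> exists e,
     [/\ e \in E, forall k, h k e = 0 \/ h k e = 1,
         forall k, 0 < h k e -> 0 < h k x & exists k, h k e = 1]) ->
  forall x, (forall k, 0 <= h k x) ->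
  exists2 c : V -> R, forall v, 0 <= c v & x = \sum_(v <- E) c v *: v.
Proof.
move=> Eu HE x; have [m] := ubnP #|[pred k | 0 < h k x]|.
elim: m x => // m IH x xm x0.
have [->|xN0] := eqVneq x 0.
  by exists (fun=> 0) => //; rewrite big1// => v _; rewrite scale0r.
have [e [eE e01 epos [k0 k0e]]] := HE x x0 xN0.
have [k k1 kmin] := arg_minP (fun k => h k x) (P := fun k => h k e == 1) (introT eqP k0e).
pose y := x - h k x *: e.
have hy j : h j y = h j x - h k x * h j e by rewrite /y linearB linearZ.
have kx : 0 < h k x by apply: epos; rewrite (eqP k1).
have y0 j : 0 <= h j y.
  rewrite hy; have [->|je] := e01 j; first by rewrite mulr0 subr0.
  by rewrite je mulr1 subr_ge0 kmin// je.
have [c c0 yE] : exists2 c : V -> R, forall v, 0 <= c v & y = \sum_(v <- E) c v *: v.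
  apply: IH => //; rewrite ltnS in xm; apply: leq_trans xm.
  apply: proper_card; apply/properP; split.
    apply/fintype.subsetP => j; rewrite !inE hy.
    have [->|->] := e01 j; first by rewrite mulr0 subr0.
    by rewrite mulr1 subr_gt0; apply: lt_trans.
  by exists k; rewrite !inE// hy (eqP k1) mulr1 subrr ltxx.
(* Since [E] has no repetition, the extra weight is counted exactly once. *)
exists (fun v => c v + (if v == e then h k x else 0)) => [v|].
  by rewrite addr_ge0//; case: eqP => // _; exact: ltW.
rewrite -[LHS](subrK (h k x *: e)) -/y yE.
under [RHS]eq_bigr do rewrite scalerDl; rewrite big_split /=; congr (_ + _).
rewrite (bigD1_seq e)//= eqxx big1 ?addr0// => v /negPf ->.
by rewrite scale0r.
Qed.

(** * The inequalities defining the monoid *)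

Local Notation constraint n :=
  (pairing n.+1 + ('I_n.+1 * 'I_n.+1) + ('I_n.+1 * 'I_n.+1))%type.

Section Slack.
Variables (n : nat) (T : realDomainType).
Implicit Types (x : pairing n.+1 -> T) (i j : 'I_n.+1).

(** The values lie in an arbitrary [T] so that the same functionals serve integral sheets and points
    of the real cone. *)
Definition entry x (i j : 'I_n.+1) : T := if insub (i, j) is Some p then x p else 0.
Definition row_sum x i : T := \sum_(j | j != i) entry x i j.
Definition row_off_first x i : T := row_sum x i - entry x i ord0.

(* The pairs [i <= j] are not only the consecutive ones: the extra inequalities
   are redundant but also take the values 0 and 1. *)
Definition slack (k : constraint n) x : T :=
  match k with
  | inl (inl p) => x p
  | inl (inr (i, j)) => if (i <= j)%N then row_sum x i - row_sum x j else 0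
  | inr (i, j) => if (0 < i <= j)%N
                  then row_off_first x i - row_off_first x j else 0
  end.

Lemma entry_pair x p : entry x (val p).1 (val p).2 = x p.
Proof. by rewrite /entry -surjective_pairing valK. Qed.

Lemma entry_diag x i : entry x i i = 0.
Proof. by rewrite /entry insubF//= eqxx. Qed.

Lemma row_sumE x i : row_sum x i = \sum_j entry x i j.
Proof. by rewrite [RHS](bigD1 i)//= entry_diag add0r. Qed.

Lemma row_off_firstE x i : row_off_first x i = \sum_(j | j != ord0) entry x i j.
Proof. by rewrite /row_off_first row_sumE (bigD1 ord0)//= addrAC subrr add0r. Qed.

Lemma row_off_first0 x : row_off_first x ord0 = row_sum x ord0.
Proof. by rewrite /row_off_first entry_diag subr0. Qed.

Section NonnegativeSlack.
Variables (x : pairing n.+1 -> T) (x0 : forall k, 0 <= slack k x).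

Lemma entry_ge0 i j : 0 <= entry x i j.
Proof. by rewrite /entry; case: insubP => // p _ _; exact: (x0 (inl (inl p))). Qed.

Lemma row_antitone i j : (i <= j)%N -> row_sum x j <= row_sum x i.
Proof. by move=> ij; have := x0 (inl (inr (i, j))); rewrite /= ij subr_ge0. Qed.

Lemma entry_le_row i j : entry x i j <= row_sum x i.
Proof. by rewrite row_sumE (bigD1 j)//= lerDl sumr_ge0// => k _; exact: entry_ge0. Qed.

Lemma row_le_row0 i : row_sum x i <= row_sum x ord0.
Proof. exact: row_antitone. Qed.

Lemma row_ge0 i : 0 <= row_sum x i.
Proof. exact: le_trans (entry_ge0 i i) (entry_le_row i i). Qed.

Lemma row_off_first_ge0 i : 0 <= row_off_first x i.
Proof. by rewrite subr_ge0 entry_le_row. Qed.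

Lemma row_off_first_le_row i : row_off_first x i <= row_sum x i.
Proof. by rewrite gerBl entry_ge0. Qed.

(** Only [0 < i] is among the constraints; for the first team the off-first sum is the whole row
    sum, which dominates every row sum and hence every off-first sum. *)
Lemma row_off_first_antitone i j : (i <= j)%N -> row_off_first x j <= row_off_first x i.
Proof.
move=> ij; have [i0|i0] := posnP i; last first.
  by have := x0 (inr (i, j)); rewrite /= i0 ij subr_ge0.
have -> : i = ord0 by exact: val_inj.
rewrite row_off_first0; exact: le_trans (row_off_first_le_row j) (row_antitone _).
Qed.

(** A slack is an entry, 0, or a difference of nonnegative numbers the larger of which is at most
    some row sum. For integral [x] with first row sum 1, this forces the values 0 and 1. *)
Lemma slack_le_row0 k : slack k x <= row_sum x ord0.
Proof.
case: k => [[p|[i j]]|[i j]] /=.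
- by rewrite -entry_pair (le_trans (entry_le_row _ _))// row_antitone.
- case: ifP => _; last exact: row_ge0.
  rewrite (le_trans _ (row_le_row0 i))// gerBl; exact: row_ge0.
case: ifP => _; last exact: row_ge0.
rewrite (le_trans _ (row_le_row0 i))// (le_trans _ (row_off_first_le_row i))//.
by rewrite gerBl row_off_first_ge0.
Qed.

Lemma eq0_of_row0 : row_sum x ord0 = 0 -> x =1 fun=> 0.
Proof.
move=> r0 p; apply/eqP; rewrite eq_le (x0 (inl (inl p))) andbT -r0.
exact: (slack_le_row0 (inl (inl p))).
Qed.

End NonnegativeSlack.

Lemma entry_linear a x y i j :
  entry (fun p => a * x p + y p) i j = a * entry x i j + entry y i j.
Proof. by rewrite /entry; case: insub => //; rewrite mulr0 addr0. Qed.

Lemma row_linear a x y i : row_sum (fun p => a * x p + y p) i = a * row_sum x i + row_sum y i.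
Proof.
by rewrite /row_sum mulr_sumr -big_split; apply: eq_bigr => j _; rewrite entry_linear.
Qed.

Lemma slack_linear a k x y :
  slack k (fun p => a * x p + y p) = a * slack k x + slack k y.
Proof.
case: k => [[p|[i j]]|[i j]] //=; case: ifP => _; rewrite ?mulr0 ?addr0//.
  by rewrite !row_linear; ring.
by rewrite /row_off_first !row_linear !entry_linear; ring.
Qed.

End Slack.

Lemma downward_closed_initial (n : nat) (P : pred 'I_n) :
  (forall i j : 'I_n, (i <= j)%N -> P j -> P i) ->
  exists2 r, (r <= n)%N & forall i : 'I_n, P i = (i < r)%N.
Proof.
move=> Pd; have ex : exists r, [forall i : 'I_n, (r <= i)%N ==> ~~ P i].
  by exists n; apply/forallP => i; rewrite leqNgt ltn_ord.
have [r /forallP rP rmin] := ex_minnP ex.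
exists r; first by apply: rmin; apply/forallP => i; rewrite leqNgt ltn_ord.
move=> i; have := rP i; case: ltnP => [ir _|_ /negPf//].
apply/negPn/negP => Pi; have := ir; rewrite ltnNge => /negP; apply; apply: rmin.
by apply/forallP => j; apply/implyP => ij; apply: contra Pi; exact: Pd.
Qed.

Lemma slack_intr (R : realDomainType) (n : nat) (z : pairing n.+1 -> int) k :
  slack k (fun p => (z p)%:~R : R) = (slack k z)%:~R.
Proof.
have eB i j : entry (fun p => (z p)%:~R : R) i j = (entry z i j)%:~R.
  by rewrite /entry; case: insub.
have rB i : row_sum (fun p => (z p)%:~R : R) i = (row_sum z i)%:~R.
  by rewrite /row_sum rmorph_sum; apply: eq_bigr => j _.
by case: k => [[p|[i j]]|[i j]] //=; case: ifP => _ //;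
  rewrite /row_off_first !rB ?eB !rmorphB.
Qed.

Lemma row_intr (R : realDomainType) (n : nat) (z : pairing n.+1 -> int) i :
  row_sum (fun p => (z p)%:~R : R) i = (row_sum z i)%:~R.
Proof.
rewrite /row_sum rmorph_sum; apply: eq_bigr => j _.
by rewrite /entry; case: insub.
Qed.

(** * The generators *)

Section Model.
Variable n : nat.
Implicit Types (f : {ffun 'I_n.+1 -> option 'I_n.+1}) (i j : 'I_n.+1).

Lemma runner_up_consistentP (g : sheet n.+1) :
  runner_up_consistent n.+1 g <-> forall k, 0 <= slack k g.
Proof.
have offE i : goals_not_against_first g i = row_off_first g i.
  by congr (_ - _); rewrite (big_pred1 ord0).
split=> [[g0 go gr] [[p|[i j]]|[i j]] //=|g0].
- by case: ifP => // ij; rewrite subr_ge0; exact: go.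
- by case: ifP => // /andP[i0 ij]; rewrite subr_ge0 -!offE; exact: gr.
split=> [p|i j ij|i j i0 ij]; first exact: (g0 (inl (inl p))).
  exact: row_antitone.
by rewrite !offE row_off_first_antitone.
Qed.

(* [f i] is the team conceding the only goal of team [i], if any. *)
Definition sheet_of f : sheet n.+1 := [ffun p => (f (val p).1 == Some (val p).2)%:R].

(** The values allowed for [f i], team by team, so that the sheets with given thresholds form a
    product that can be counted factor by factor. The case [r = q] is the pattern of [A_n], and
    [r < q] that of [B_n]. *)
Definition scorers (r q : nat) i : pred (option 'I_n.+1) :=
  if (i < r)%N then [pred o | if o is Some j then (j != ord0) && (j != i) else false]
  else if (i < q)%N then pred1 (Some ord0) else pred1 None.

Section SheetOf.
Variables (r q : nat) (f : {ffun 'I_n.+1 -> option 'I_n.+1}).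
Hypotheses (r0 : (0 < r)%N) (rq : (r <= q)%N) (ff : f \in family (scorers r q)).

Lemma scorers_at i : f i \in scorers r q i.
Proof. by move/familyP: ff; apply. Qed.

(** [sheet_of] forgets diagonal values of [f], so these must be excluded. The only delicate value is
    [Some ord0]: it is taken from index [r] on, and [0 < r] keeps the first team out of that
    range. *)
Lemma sheet_of_irrefl i : f i != Some i.
Proof.
have := scorers_at i; rewrite /scorers; case: ltnP => [_|ri].
  by rewrite inE; case: (f i) => // j /andP[_ ji]; apply: contra ji => /eqP[->].
case: ifP => _; rewrite inE => /eqP -> //; apply/eqP => -[i0].
by move: ri; rewrite -i0 leqNgt r0.
Qed.

Lemma entry_sheet_of i j : entry (sheet_of f) i j = (f i == Some j)%:R.
Proof.
rewrite /entry; case: insubP => [p _ pE|/=]; first by rewrite ffunE pE.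
by rewrite negbK => /eqP <-; rewrite (negPf (sheet_of_irrefl _)).
Qed.

Lemma scorers_isSome i : isSome (f i) = (i < q)%N.
Proof.
have := scorers_at i; rewrite /scorers; case: ltnP => [ir|ri].
  by rewrite inE (leq_trans ir rq); case: (f i).
by case: ifP => _; rewrite inE => /eqP ->.
Qed.

Lemma row_sheet_of i : row_sum (sheet_of f) i = (i < q)%:R.
Proof.
rewrite row_sumE -scorers_isSome; under eq_bigr do rewrite entry_sheet_of.
case: (f i) => [j|]; last by rewrite big1.
rewrite (bigD1 j)//= eqxx big1 ?addr0// => k /negPf kj.
by rewrite eq_sym; case: eqP => // -[/eqP]; rewrite kj.
Qed.

Lemma row_off_first_sheet_of i : row_off_first (sheet_of f) i = (i < r)%:R.
Proof.
rewrite /row_off_first row_sheet_of entry_sheet_of.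
have := scorers_at i; rewrite /scorers; case: ltnP => [ir|ri].
  rewrite inE (leq_trans ir rq); case: (f i) => // j /andP[j0 _].
  have /negPf -> : Some j != Some ord0 by apply: contra j0 => /eqP[->].
  by rewrite subr0.
by case: ifP => _; rewrite inE => /eqP -> //; rewrite eqxx subrr.
Qed.

Lemma slack_sheet_of k : 0 <= slack k (sheet_of f).
Proof.
case: k => [[p|[i j]]|[i j]] /=; first by rewrite ffunE ler0n.
  case: ifP => // ij; rewrite !row_sheet_of subr_ge0 ler_nat.
  by case: (ltnP j q) => // jq; rewrite (leq_ltn_trans ij jq).
case: ifP => // /andP[i0 ij]; rewrite !row_off_first_sheet_of subr_ge0 ler_nat.
by case: (ltnP j r) => // jr; rewrite (leq_ltn_trans ij jr).
Qed.

Lemma row0_sheet_of : row_sum (sheet_of f) ord0 = 1.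
Proof. by rewrite row_sheet_of (leq_trans r0 rq). Qed.

End SheetOf.

(* Subtracting a small multiple of the sheet found here keeps all the
   inequalities true. *)
Lemma sheet_below (T : realDomainType) (x : pairing n.+1 -> T) :
  (forall k, 0 <= slack k x) -> row_sum x ord0 != 0 ->
  exists r q f, [/\ [&& 0 < r, r <= q & q <= n.+1]%N, f \in family (scorers r q) &
    forall k, 0 < slack k (sheet_of f) -> 0 < slack k x].
Proof.
move=> x0 xN0; have row0 : 0 < row_sum x ord0 by rewrite lt0r xN0 row_ge0.
have [r rn rE] : exists2 r, (r <= n.+1)%N &
    forall i, (0 < row_off_first x i) = (i < r)%N.
  apply: downward_closed_initial => i j ij /lt_le_trans; apply.
  exact: row_off_first_antitone.
have [q qn qE] : exists2 q, (q <= n.+1)%N & forall i, (0 < row_sum x i) = (i < q)%N.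
  apply: downward_closed_initial => i j ij /lt_le_trans; apply; exact: row_antitone.
have r0 : (0 < r)%N by rewrite -(rE ord0) row_off_first0.
(* Otherwise team [q] would have a positive off-first sum but no positive row sum. *)
have rq : (r <= q)%N.
  rewrite leqNgt; apply/negP => qr.
  have qn1 : (q < n.+1)%N by exact: leq_trans qr rn.
  have : 0 < row_sum x (Ordinal qn1).
    apply: lt_le_trans (row_off_first_le_row x0 _); by rewrite rE.
  by rewrite qE ltnn.
pose f := [ffun i : 'I_n.+1 =>
  if (i < r)%N then [pick j | [&& j != ord0, j != i & 0 < entry x i j]]
  else if (i < q)%N then Some ord0 else None].
have ff : f \in family (scorers r q).
  apply/familyP => i; rewrite ffunE /scorers.
  case: ifP => ir; last by case: ifP; rewrite inE.
  (* The search cannot fail: a positive off-first sum of nonnegative entries has a positive term. *)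
  case: pickP => [j /and3P[j0 ji _]|none]; first by rewrite inE j0 ji.
  move: ir; rewrite -rE row_off_firstE big1 ?ltxx// => j j0; apply/eqP.
  have := none j; rewrite j0 /= lt0r entry_ge0// andbT.
  by case: (eqVneq j i) => [->|_ /negPn //]; rewrite entry_diag eqxx.
exists r, q, f; split=> //; first by rewrite r0 rq qn.
case=> [[p|[i j]]|[i j]] /=.
- rewrite -[_ p]entry_pair (entry_sheet_of r0 ff) ltr0n lt0b.
  rewrite ffunE -(entry_pair x); move: (val p).1 (val p).2 => i j.
  case: ifP => [_|ir].
    by case: pickP => // j' /and3P[_ _ pos] /eqP[<-].
  case: ifP => // iq /eqP[<-].
  (* From [r] on the off-first sum is 0, so the whole row sum sits in the first column. *)
  have <- : row_sum x i = entry x i ord0; last by rewrite qE.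
  apply/eqP; rewrite -subr_eq0; move/negbT: ir.
  by rewrite -rE lt0r row_off_first_ge0// andbT negbK.
- case: ifP => // ij; rewrite !(row_sheet_of r0 rq ff) -!qE.
  (* If row [j] has positive sum, the slack of the sheet is at most 0; otherwise the slack of [x] is
     just the sum of row [i]. *)
  have := row_ge0 x0 j; rewrite le_eqVlt => /predU1P[<-|->]; last first.
    by case: (0 < row_sum x i); rewrite ?subrr ?ltxx// sub0r ltrNr oppr0 ltr10.
  by rewrite ltxx /= !subr0; case: (0 < row_sum x i); rewrite ?ltxx.
case: ifP => // ij; rewrite !(row_off_first_sheet_of r0 rq ff) -!rE.
have := row_off_first_ge0 x0 j; rewrite le_eqVlt => /predU1P[<-|->]; last first.
  by case: (0 < row_off_first x i); rewrite ?subrr ?ltxx// sub0r ltrNr oppr0 ltr10.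
by rewrite ltxx /= !subr0; case: (0 < row_off_first x i); rewrite ?ltxx.
Qed.

End Model.

(** * Irreducible sheets and their patterns *)

Section Sheets.
Variable n : nat.
Implicit Types (f : {ffun 'I_n.+1 -> option 'I_n.+1}) (g e : sheet n.+1).

Lemma sheetB_ext g e :
  (g - e : sheet n.+1) = (fun p => -1 * e p + g p) :> (pairing n.+1 -> int).
Proof. by apply/funext => p; rewrite !ffunE mulN1r addrC. Qed.

Lemma slack_sheetB g e k : slack k (g - e : sheet n.+1) = slack k g - slack k e.
Proof. by rewrite sheetB_ext slack_linear mulN1r addrC. Qed.

Lemma row_sheetB g e i : row_sum (g - e : sheet n.+1) i = row_sum g i - row_sum e i.
Proof. by rewrite sheetB_ext row_linear mulN1r addrC. Qed.

Lemma slack_sheetD g e k : slack k (g + e : sheet n.+1) = slack k g + slack k e.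
Proof. by rewrite -{2}(addrK e g) slack_sheetB subrK. Qed.

Lemma row_sheetD g e i : row_sum (g + e : sheet n.+1) i = row_sum g i + row_sum e i.
Proof. by rewrite -{2}(addrK e g) row_sheetB subrK. Qed.

Lemma sheet_eq0 g : (forall k, 0 <= slack k g) -> row_sum g ord0 = 0 -> g = 0.
Proof. by move=> g0 r0; apply/ffunP => p; rewrite (eq0_of_row0 g0 r0) ffunE. Qed.

Lemma row_sheet0 i : row_sum (0 : sheet n.+1) i = 0.
Proof. by rewrite -(subrr (0 : sheet n.+1)) row_sheetB subrr. Qed.

Lemma slack_sheet0 k : slack k (0 : sheet n.+1) = 0.
Proof. by rewrite -(subrr (0 : sheet n.+1)) slack_sheetB subrr. Qed.

(** Over the integers the coefficient 1 works: the slacks of [sheet_of f] are at most its first row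
    sum 1, and where one of them is 1 the slack of [g] is a positive integer. *)
Lemma unit_sheet_below g : (forall k, 0 <= slack k g) -> g != 0 ->
  exists r q f, [/\ [&& 0 < r, r <= q & q <= n.+1]%N, f \in family (scorers r q) &
    forall k, 0 <= slack k (g - sheet_of f)].
Proof.
move=> g0 gN0; have rN0 : row_sum g ord0 != 0 by apply: contra_neq gN0; exact: sheet_eq0.
have [r [q [f [rq ff fg]]]] := sheet_below g0 rN0; exists r, q, f; split=> // k.
have [r0 rq' qn] := and3P rq.
have := fg k; have := slack_le_row0 (slack_sheet_of r0 rq' ff) k.
rewrite (row0_sheet_of r0 rq' ff) slack_sheetB.
have := g0 k; have := slack_sheet_of r0 rq' ff k; lia.
Qed.

(** The first row sum is a grading that vanishes only at 0, so degree 1 implies irreducible.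
    Conversely, an irreducible sheet must equal the degree 1 sheet that can be subtracted from
    it. *)
Lemma irreducible_sheetP g : irreducible_in (runner_up_consistent n.+1) g <->
  runner_up_consistent n.+1 g /\ row_sum g ord0 = 1.
Proof.
split=> [[/runner_up_consistentP g0 gN0 girr]|[/runner_up_consistentP g0 g1]].
  have [r [q [f [/and3P[r0 rq qn] ff gf]]]] := unit_sheet_below g0 gN0.
  have f1 := row0_sheet_of r0 rq ff.
  split; first exact/runner_up_consistentP.
  have [|||f0|gf0] := girr (sheet_of f) (g - sheet_of f).
  - by apply/runner_up_consistentP; exact: (slack_sheet_of r0 rq ff).
  - exact/runner_up_consistentP.
  - by rewrite addrC subrK.
  - by move: f1; rewrite f0 row_sheet0.
  by rewrite -f1 -[in LHS](subrK (sheet_of f) g) gf0 add0r.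
split; first exact/runner_up_consistentP.
  by apply: contra_eq_neq g1 => ->; rewrite row_sheet0.
move=> y z /runner_up_consistentP y0 /runner_up_consistentP z0 gyz.
move: g1; rewrite gyz row_sheetD => g1.
have := row_ge0 y0 ord0; have := row_ge0 z0 ord0 => zr yr.
have [yr0|zr0] : row_sum y ord0 = 0 \/ row_sum z ord0 = 0.
  by move: (row_sum y ord0) (row_sum z ord0) g1 zr yr => a b /=; lia.
- by left; exact: sheet_eq0.
- by right; exact: sheet_eq0.
Qed.

(** Induction on the first row sum, which drops by 1 with each subtracted unit sheet. *)
Lemma generated_by_irreducible :
  generated_by (hilbert_basis (runner_up_consistent n.+1)) = runner_up_consistent n.+1.
Proof.
apply/seteqP; split=> g.
  move=> [s [sH ->]]; apply/runner_up_consistentP => k.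
  elim: s sH => [|e s IH] sH; first by rewrite big_nil slack_sheet0.
  rewrite big_cons slack_sheetD addr_ge0//.
    by have [] := sH e (mem_head _ _) => /runner_up_consistentP.
  by apply: IH => x xs; apply: sH; rewrite /= inE xs orbT.
move=> /runner_up_consistentP; have [m] := ubnP `|row_sum g ord0|%N.
elim: m g => // m IH g gm g0.
have [->|gN0] := eqVneq g 0; first by exists [::]; rewrite big_nil.
have [r [q [f [/and3P[r0 rq qn] ff gf]]]] := unit_sheet_below g0 gN0.
have f1 := row0_sheet_of r0 rq ff.
have [|//|s [sH sE]] := IH (g - sheet_of f).
  move: gm; have := row_ge0 gf ord0; rewrite row_sheetB f1.
  by move: (row_sum g ord0) => a /=; lia.
exists (sheet_of f :: s); split; last by rewrite big_cons -sE addrC subrK.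
move=> e /=; rewrite inE => /predU1P[->|/sH//].
apply/irreducible_sheetP; split=> //.
by apply/runner_up_consistentP; exact: (slack_sheet_of r0 rq ff).
Qed.

(* The paper's [r] and [q] are [r + 1] and [q + 1] here. *)
Definition models (D : rel 'I_n.+1) : set (sheet n.+1) :=
  [set g | exists r q : 'I_n.+1, exists2 f, D r q /\ (r <= q)%N &
     f \in family (scorers r.+1 q.+1) /\ g = sheet_of f].

Lemma hilbert_basisE :
  hilbert_basis (runner_up_consistent n.+1) = models (fun r q => (r <= q)%N).
Proof.
apply/seteqP; split=> g.
  move=> /irreducible_sheetP[/runner_up_consistentP g0 g1].
  have gN0 : g != 0 by apply: contra_eq_neq g1 => ->; rewrite row_sheet0.
  have [[|r] [[|q] [f [//= /andP[rq qn] ff gf]]]] := unit_sheet_below g0 gN0.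
  have rn := leq_trans rq qn.
  exists (Ordinal rn), (Ordinal qn), f => //; split=> //.
  (* The remainder has first row sum [1 - 1], so it vanishes. *)
  apply/eqP; rewrite -subr_eq0; apply/eqP/sheet_eq0 => //.
  by rewrite row_sheetB g1 (row0_sheet_of _ _ ff)// subrr.
move=> [r [q [f [_ rq] [ff ->]]]]; apply/irreducible_sheetP; split.
  by apply/runner_up_consistentP; exact: (slack_sheet_of _ _ ff).
exact: (row0_sheet_of _ _ ff).
Qed.

(** Translates the row-by-row conditions defining [A_n] and [B_n] into a choice function; for
    [r = q] the condition on the middle rows is vacuous. *)
Lemma patternP (r q : nat) g : (0 < r)%N -> (r <= q)%N ->
  [/\ score_sheet g, forall i : 'I_n.+1, (i < r)%N -> one_goal_not_first g i,
      forall i : 'I_n.+1, (r <= i < q)%N -> one_goal_first g i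
    & forall i : 'I_n.+1, (q <= i)%N -> no_goal g i] <->
  exists2 f, f \in family (scorers r q) & g = sheet_of f.
Proof.
move=> r0 rq; split=> [[g0 gr gq gn]|[f ff ->]]; last first.
  have fE i j : goals (sheet_of f) i j = (f i == Some j)%:R.
    exact: (entry_sheet_of r0 ff).
  split=> [p|i ir|i /andP[ri iq] j ji|i qi j ji].
  - by rewrite ffunE ler0n.
  - have := scorers_at ff i; rewrite /scorers ir inE.
    case fi: (f i) => [j|//] /andP[j0 ji]; exists j; split=> //.
      by rewrite fE fi eqxx.
    by move=> k /negPf kj; rewrite fE fi eq_sym; case: eqP => // -[/eqP]; rewrite kj.
  - have := scorers_at ff i; rewrite fE /scorers ltnNge ri iq inE => /eqP ->.
    congr (_%:R); rewrite eq_sym; congr nat_of_bool;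
      by apply/eqP/eqP => [[->]//|j0]; congr Some; exact: val_inj.
  have := scorers_at ff i; rewrite fE /scorers ltnNge (leq_trans rq qi) ltnNge qi inE.
  by move=> /eqP ->.
(* A row has at most one entry equal to 1, and [f i] locates it. *)
pose f := [ffun i : 'I_n.+1 => [pick j | (j != i) && (goals g i j == 1)]].
have fP i : (f i \in scorers r q i) /\ forall j, j != i -> goals g i j = (f i == Some j)%:R.
  rewrite ffunE /scorers; case: ltnP => [ir|ri].
    have [j [j0 ji gj gNj]] := gr i ir.
    case: pickP => [j' /andP[j'i gj']|/(_ j)]; last by rewrite ji gj eqxx.
    have -> : j' = j by apply/eqP; apply: contraTT gj' => /gNj ->.
    split=> [|k ki]; first by rewrite inE j0 ji.
    have [<-|jk] := eqVneq j k; first by rewrite gj eqxx.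
    have /negPf -> : Some j != Some k by apply: contra jk => /eqP[->].
    by rewrite gNj// eq_sym.
  case: ltnP => [iq|qi].
    have gi := gq i; rewrite ri iq in gi; have {}gi := gi isT.
    have i0 : ord0 != i by rewrite -val_eqE /= eq_sym -lt0n (leq_trans r0).
    case: pickP => [j /andP[ji]|/(_ ord0)]; last by rewrite i0 gi// eqxx.
    rewrite gi// pnatr_eq1 eqb1 => /eqP j0; have -> : j = ord0 by exact: val_inj.
    split=> [|k ki]; first by rewrite inE.
    rewrite gi//; congr (_%:R); congr nat_of_bool;
      by apply/eqP/eqP => [k0|[<-]//]; congr Some; exact: val_inj.
  case: pickP => [j /andP[ji]|none]; first by rewrite gn.
  by split=> [|k ki]; rewrite ?inE ?gn.
exists f; first by apply/familyP => i; case: (fP i).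
apply/ffunP => p; rewrite ffunE; case: (fP (val p).1) => _ <-.
  by rewrite -[LHS](entry_pair g).
by rewrite eq_sym; exact: (valP p).
Qed.

Lemma sheets_AE : sheets_A n.+1 = models (fun r q => r == q).
Proof.
apply/seteqP; split=> g.
  move=> [g0 [[|r] [//= rn gr gn]]].
  have [|f ff gf] := (@patternP r.+1 r.+1 g (ltn0Sn _) (leqnn _)).1.
    by split=> // i /andP[ri]; rewrite ltnNge ri.
  by exists (Ordinal rn), (Ordinal rn), f; [|split].
move=> [r [q [f [/eqP <- _] [ff ->]]]].
have [|g0 gr _ gn] := (@patternP r.+1 r.+1 (sheet_of f) (ltn0Sn _) (leqnn _)).2.
  by exists f.
by split=> //; exists r.+1; split=> //=.
Qed.

Lemma sheets_BE : sheets_B n.+1 = models (fun r q => (r < q)%N).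
Proof.
apply/seteqP; split=> g.
  move=> [g0 [[|r] [[|q] [//= /andP[rq qn] gr gq gn]]]].
  have rn : (r < n.+1)%N by apply: leq_trans qn; exact: ltnW.
  have [|f ff gf] := (@patternP r.+1 q.+1 g (ltn0Sn _) (ltnW rq)).1; first by split.
  by exists (Ordinal rn), (Ordinal qn), f; split=> //; exact: ltnW.
move=> [r [q [f [rq rq'] [ff ->]]]].
have [|g0 gr gq gn] := (@patternP r.+1 q.+1 (sheet_of f) (ltn0Sn _) rq').2.
  by exists f.
by split=> //; exists r.+1, q.+1; split=> //; apply/and3P.
Qed.

Lemma sheets_ABE : hilbert_basis (runner_up_consistent n.+1) =
  sheets_A n.+1 `|` sheets_B n.+1.
Proof.
rewrite hilbert_basisE sheets_AE sheets_BE; apply/seteqP; split=> g.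
  move=> [r [q [f [_ rq] ff]]].
  move: (rq); rewrite leq_eqVlt => /orP[req|rltq]; [left|right]; exists r, q, f => //.
by case=> -[r [q [f [_ rq] ff]]]; exists r, q, f.
Qed.

End Sheets.

(** When an irreducible element is a sum of generators, splitting off one summand at a time shows
    that it is itself a generator. So every generating set contains the irreducible elements, which
    generate. *)
Lemma minimal_generating_hilbert_basis (n : nat) :
  let M := runner_up_consistent n.+1 in
  minimal_generating_set M (hilbert_basis M) /\
  forall G, minimal_generating_set M G -> G = hilbert_basis M.
Proof.
move=> M.
have irr_sub G : generated_by G = M -> hilbert_basis M `<=` G.
  move=> GM g [Mg gN0 girr].
  have GsubM x : G x -> M x.
    move=> Gx; rewrite -GM; exists [:: x]; rewrite big_seq1; split=> // y /=.
    by rewrite inE => /eqP ->.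
  move: (Mg); rewrite -GM => -[s [sG gE]].
  elim: s sG gE => [|x s IH] sG; first by rewrite big_nil => g0; rewrite g0 eqxx in gN0.
  have Gx : G x by apply: sG; exact: mem_head.
  have sG' : [set` s] `<=` G by move=> y ys; apply: sG; rewrite /= inE ys orbT.
  rewrite big_cons => gE; have [||x0|s0] := girr _ _ _ _ gE.
  - exact: GsubM.
  - by rewrite -GM; exists s.
  - by apply: IH; rewrite // gE x0 add0r.
  by rewrite gE s0 addr0.
have HBgen := @generated_by_irreducible n.
split; first by split=> // G' sub /irr_sub sub'; exact/seteqP.
by move=> G [GM Gmin]; rewrite (Gmin _ (irr_sub _ GM) HBgen).
Qed.

(** * Counting *)

Lemma card_ord_lt (n r : nat) : (r <= n)%N -> #|[pred i : 'I_n | (i < r)%N]| = r.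
Proof.
move=> rn; rewrite -sum1_card -[RHS]card_ord -[RHS]sum1_card.
by rewrite (big_ord_widen n (fun=> 1%N) rn).
Qed.

Lemma card_ord_ge (n r : nat) : (r <= n)%N -> #|[pred i : 'I_n | (r <= i)%N]| = (n - r)%N.
Proof.
move=> rn; rewrite -[in RHS](card_ord n) -(cardC [pred i : 'I_n | (i < r)%N]) card_ord_lt//.
by rewrite addKn; apply: eq_card => i; rewrite !inE -leqNgt.
Qed.

Lemma natr_bool_inj (b c : bool) : b%:R = c%:R :> int -> b = c.
Proof. by case: b; case: c. Qed.

Section Counting.
Variable n : nat.
Implicit Types (f : {ffun 'I_n.+1 -> option 'I_n.+1}) (r q : 'I_n.+1).

(** The scorers off the first team are the teams 0 to [r]. Team 0 has [n] choices, as its two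
    exclusions coincide; each of the [r] others has [n - 1], and every later team has a single
    one. *)
Lemma card_scorers r (q : nat) :
  #|family (scorers (n := n) r.+1 q)| = (n * (n - 1) ^ r)%N.
Proof.
have cardS (i : 'I_n.+1) : (i < r.+1)%N ->
    #|scorers (n := n) r.+1 q i| = #|[pred j : 'I_n.+1 | (j != ord0) && (j != i)]|.
  move=> ir; rewrite -[RHS](fintype.card_image Some_inj); apply: eq_card => o.
  rewrite /scorers ir inE; apply/idP/fintype.imageP.
    by case: o => // j jP; exists j.
  by move=> [j jP ->].
have card0 : #|[pred j : 'I_n.+1 | (j != ord0) && (j != ord0)]| = n.
  rewrite -[RHS]/(n.+1.-1) -[in RHS](card_ord n.+1) -(cardC1 (ord0 : 'I_n.+1)).
  by apply: eq_card => j; rewrite !inE andbb.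
have cardN0 (i : 'I_n) :
    #|[pred j : 'I_n.+1 | (j != ord0) && (j != lift ord0 i)]| = (n - 1)%N.
  have -> : (n - 1 = n.+1 - 2)%N by rewrite subSS.
  rewrite -[in RHS](card_ord n.+1) -(cardC (pred2 (ord0 : 'I_n.+1) (lift ord0 i))) card2.
  rewrite neq_lift addKn; apply: eq_card => j.
  by rewrite !inE negb_or.
rewrite card_family foldrE big_image /=.
rewrite big_ord_recl cardS// card0; congr (_ * _)%N.
under eq_bigr => i _.
  rewrite (_ : #|_| = if (i < r)%N then (n - 1)%N else 1%N); first over.
  case: ltnP => ir; first by rewrite cardS ?lift0 ?cardN0.
  by rewrite /scorers lift0 ltnS ltnNge ir /=; case: ifP; rewrite card1.
by rewrite -big_mkcond prod_nat_const card_ord_lt// -ltnS.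
Qed.

Lemma eq_initial r q : (forall i : 'I_n.+1, (i < r.+1)%N = (i < q.+1)%N) -> r = q.
Proof.
move=> rq; apply/val_inj/eqP; rewrite eqn_leq.
by have := rq r; have := rq q; rewrite !ltnS !leqnn => -> <-.
Qed.

(** The thresholds can be read off from [f]: [r] from the off-first sums of its sheet, [q] from the
    teams that score. So distinct thresholds give disjoint families. *)
Lemma family_scorers_inj f r q r' q' : (r <= q)%N -> (r' <= q')%N ->
  f \in family (scorers r.+1 q.+1) -> f \in family (scorers r'.+1 q'.+1) ->
  (r = r') * (q = q').
Proof.
rewrite -[(r <= q)%N]ltnS -[(r' <= q')%N]ltnS => rq rq' ff ff'; split; apply: eq_initial => i.
  apply: natr_bool_inj.
  rewrite -(row_off_first_sheet_of (ltn0Sn _) rq ff).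
  by rewrite -(row_off_first_sheet_of (ltn0Sn _) rq' ff').
by rewrite -(scorers_isSome rq ff) -(scorers_isSome rq' ff').
Qed.

Lemma sheet_of_inj f f' r r' (q q' : nat) :
  f \in family (scorers r.+1 q) -> f' \in family (scorers r'.+1 q') ->
  sheet_of f = sheet_of f' -> f = f'.
Proof.
move=> ff ff' E; apply/ffunP => i.
have eqE j : (f i == Some j) = (f' i == Some j).
  apply: natr_bool_inj.
  by rewrite -(entry_sheet_of (ltn0Sn _) ff) -(entry_sheet_of (ltn0Sn _) ff') E.
case E1: (f i) => [j|]; first by apply/esym/eqP; rewrite -eqE E1.
by case E2: (f' i) => [j|//]; have := eqE j; rewrite E1 E2 eqxx.
Qed.

(** [S] is the disjoint union of the families over the admissible thresholds, and [sheet_of] is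
    injective on it. The size of a family depends on [r] only, so each [r] is weighted by its number
    of admissible [q]. *)
Lemma card_models (D : rel 'I_n.+1) :
  models D #= `I_(n * \sum_(r < n.+1) (n - 1) ^ r * #|[pred q | D r q && (r <= q)%N]|)%N.
Proof.
pose Dle (t : 'I_n.+1 * 'I_n.+1) := D t.1 t.2 && (t.1 <= t.2)%N.
pose fam (t : 'I_n.+1 * 'I_n.+1) := family (scorers (n := n) t.1.+1 t.2.+1).
pose S := [set f | [exists t, Dle t && (f \in fam t)]]%SET.
have -> : (n * \sum_(r < n.+1) (n - 1) ^ r * #|[pred q | D r q && (r <= q)%N]|)%N = #|S|.
  transitivity (\sum_(t | Dle t) #|fam t|)%N.
    rewrite big_distrr /= -(pair_big_dep xpredT (fun r q => D r q && (r <= q)%N)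
      (fun r q => #|fam (r, q)|)) /=.
    apply: eq_bigr => r _; rewrite mulnA -sum1_card big_distrr /=.
    by apply: eq_big => q // _; rewrite muln1 card_scorers.
  rewrite -sum1_card; under eq_bigr do rewrite -sum1_card big_mkcond /=.
  (* Summing over [f] first, each member of [S] is counted for exactly one pair of thresholds. *)
  rewrite exchange_big [RHS]big_mkcond; apply: eq_bigr => f _.
  rewrite !inE; case: existsP => [[t /andP[Dt ft]]|none].
    rewrite (bigD1 t)//= ft big1 ?addn0// => t' /andP[/andP[Dt' tt'] t't].
    case: ifP => // ft'; move: t't; case/andP: Dt => _ tt.
    have [E1 E2] := family_scorers_inj tt tt' ft ft'.
    by rewrite [t']surjective_pairing -E1 -E2 -surjective_pairing eqxx.
  rewrite big1// => t Dt; case: ifP => // ft.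
  by case: none; exists t; rewrite Dt.
have SP f : f \in S -> exists t, Dle t && (f \in fam t).
  by rewrite inE => /existsP.
have -> : models D = (fun i : 'I_#|S| => sheet_of (enum_val i)) @` [set: 'I_#|S|].
  apply/seteqP; split=> [g [r [q [f [Drq rq] [ff ->]]]]|_ [i _ <-]].
    have fS : f \in S.
      by rewrite inE; apply/existsP; exists (r, q); rewrite /Dle /= Drq rq.
    by exists (enum_rank_in fS f) => //; rewrite enum_rankK_in.
  have [t /andP[/andP[Dt tt] ft]] := SP _ (enum_valP i).
  by exists t.1, t.2, (enum_val i).
rewrite card_eq_sym (card_eql card_II) card_eq_sym; apply: inj_card_eq => i j _ _ E.
apply: enum_val_inj.
have [t /andP[_ ft]] := SP _ (enum_valP i); have [t' /andP[_ ft']] := SP _ (enum_valP j).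
exact: sheet_of_inj ft ft' E.
Qed.

Lemma card_sheets_A :
  sheets_A n.+1 #= `I_((n.+1 - 1) * \sum_(0 <= i < n.+1) (n.+1 - 2) ^ i)%N.
Proof.
rewrite sheets_AE; have := card_models (fun r q => r == q).
rewrite big_mkord !subSS subn0.
under eq_bigr => r _.
  rewrite (_ : #|_| = 1%N); last first.
    rewrite -(card1 r); apply: eq_card => q.
    by rewrite !inE eq_sym; case: eqP => // ->; rewrite leqnn.
  rewrite muln1; over.
by [].
Qed.

Lemma card_sheets_B :
  sheets_B n.+1 #= `I_((n.+1 - 1) * \sum_(0 <= i < n.+1) (n.+1 - 2) ^ i * (n.+1 - i - 1))%N.
Proof.
rewrite sheets_BE; have := card_models (fun r q => (r < q)%N).
rewrite big_mkord !subSS subn0.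
under eq_bigr => r _.
  rewrite (_ : #|_| = (n.+1 - r - 1)%N); last first.
    rewrite -subnDA addn1 -card_ord_ge//; apply: eq_card => q.
    by rewrite !inE andb_idr// => /ltnW.
  over.
by [].
Qed.

Lemma card_hilbert_basis :
  hilbert_basis (runner_up_consistent n.+1) #=
  `I_((n.+1 - 1) * \sum_(0 <= i < n.+1) (n.+1 - 2) ^ i * (n.+1 - i))%N.
Proof.
rewrite hilbert_basisE; have := card_models (fun r q => (r <= q)%N).
rewrite big_mkord !subSS subn0.
under eq_bigr => r _.
  rewrite (_ : #|_| = (n.+1 - r)%N); last first.
    rewrite -card_ord_ge 1?ltnW//; apply: eq_card => q.
    by rewrite !inE andbb.
  over.
by [].
Qed.

End Counting.

(** The power [a ^ i] occurs on the right once for each [k] with [i <= k < m]. *)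
Lemma sum_expn_weighted (a m : nat) :
  (\sum_(0 <= i < m) a ^ i * (m - i) = \sum_(0 <= k < m) \sum_(0 <= i < k.+1) a ^ i)%N.
Proof.
elim: m => [|m IH]; first by rewrite !big_nil.
rewrite [RHS]big_nat_recr//= -IH [in RHS]big_nat_recr//= addnA -big_split /=.
rewrite [LHS]big_nat_recr//= subSnn muln1; congr (_ + _)%N.
by apply: eq_big_nat => i /andP[_ im]; rewrite subSn 1?ltnW// mulnS addnC.
Qed.

(** * The cone and the polytope *)

(** The nonnegative gaps [b - l v], weighted by [c], add up to 0, so each gap of nonzero weight
    vanishes. This covers polytopes, with total weight 1, and cones, with [b = 0]. *)
Lemma support_tight (R : realFieldType) (V : vectType R) (l : {scalar V}) (b : R)
    (s : seq V) (c : V -> R) :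
  (forall v, 0 <= c v) -> (forall v, v \in s -> l v <= b) ->
  l (\sum_(v <- s) c v *: v) = (\sum_(v <- s) c v) * b ->
  forall v, v \in s -> c v != 0 -> l v = b.
Proof.
move=> c0 lb lE v vs cv.
have : \sum_(w <- s | w \in s) c w * (b - l w) == 0.
  rewrite -big_seq; under eq_bigr do rewrite mulrBr.
  rewrite sumrB -mulr_suml -lE linear_sum -sumrB big1// => w _.
  by rewrite linearZ subrr.
rewrite psumr_eq0 => [|w ws]; last by rewrite mulr_ge0// subr_ge0 lb.
move=> /allP /(_ _ vs); rewrite vs mulf_eq0 (negPf cv) subr_eq0 /=.
by move/eqP.
Qed.

Lemma cone_set1 (R : realFieldType) (V : vectType R) (w x : V) :
  cone [set w] x <-> exists2 t : R, 0 <= t & x = t *: w.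
Proof.
split=> [[s [c [sw c0 ->]]]|[t t0 ->]].
  exists (\sum_(v <- s) c v); first by rewrite sumr_ge0.
  by rewrite scaler_suml; apply: eq_big_seq => v /sw ->.
exists [:: w], (fun=> t); split=> //; last by rewrite big_seq1.
by move=> v; rewrite /= inE => /eqP.
Qed.

Lemma has_dim_ray (R : realFieldType) (V : vectType R) (w : V) :
  w != 0 -> has_dim (cone [set w]) 1.
Proof.
move=> w0; exists [:: 0; w]; split=> //=.
- by rewrite seq1_free subr0.
- move=> v; rewrite /= !inE => /orP[]/eqP ->; apply/cone_set1.
    by exists 0; rewrite ?scale0r.
  by exists 1; rewrite ?scale1r.
move=> x /cone_set1[t _ ->]; exists [:: 0; w], (fun v => if v == 0 then 1 - t else t).
split=> //; rewrite !big_cons big_nil eqxx (negPf w0) addr0 ?subrK//.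
by rewrite scaler0 add0r.
Qed.

Section Geometry.
Variables (R : realFieldType) (n : nat).
Local Notation V := (Defs.space R (pairing n.+1)).
Local Notation M := (runner_up_consistent n.+1).
Local Notation HB := (hilbert_basis M).

Definition slack_of (k : constraint n) (x : V) : R := slack k (x : pairing n.+1 -> R).
Definition row_of (i : 'I_n.+1) (x : V) : R := row_sum (x : pairing n.+1 -> R) i.

Lemma space_linear_ext (a : R) (x y : V) :
  (a *: x + y : V) = (fun p => a * x p + y p) :> (pairing n.+1 -> R).
Proof. by apply/funext => p; rewrite !ffunE. Qed.

Lemma slack_of_linear k : scalar (slack_of k).
Proof. by move=> a x y; rewrite /slack_of space_linear_ext slack_linear. Qed.

Lemma row_of_linear i : scalar (row_of i).
Proof. by move=> a x y; rewrite /row_of space_linear_ext row_linear. Qed.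

HB.instance Definition _ k := GRing.isLinear.Build R V R *%R (slack_of k) (slack_of_linear k).
HB.instance Definition _ i := GRing.isLinear.Build R V R *%R (row_of i) (row_of_linear i).

(** The functional exposing [g]. The sign is negative because a face is where a functional attains
    its upper bound, here 0. *)
Definition tight_sum (g : sheet n.+1) (x : V) : R :=
  - \sum_(k | slack k g == 0) slack_of k x.

Lemma tight_sum_linear g : scalar (tight_sum g).
Proof.
move=> a x y; rewrite /tight_sum mulrN -opprD mulr_sumr -big_split; congr (- _).
by apply: eq_bigr => k _; rewrite linearP.
Qed.

HB.instance Definition _ g := GRing.isLinear.Build R V R *%R (tight_sum g) (tight_sum_linear g).

Local Notation lam := (row_of ord0 : {scalar V}).
Local Notation h := (fun k => slack_of k : {scalar V}).

Lemma embed_ext (g : sheet n.+1) :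
  embed R g = (fun p => (g p)%:~R) :> (pairing n.+1 -> R).
Proof. by apply/funext => p; rewrite ffunE. Qed.

Lemma slack_embed k (g : sheet n.+1) : slack_of k (embed R g) = (slack k g)%:~R.
Proof. by rewrite /slack_of embed_ext slack_intr. Qed.

Lemma row_embed i (g : sheet n.+1) : row_of i (embed R g) = (row_sum g i)%:~R.
Proof. by rewrite /row_of embed_ext row_intr. Qed.

Lemma space_eq0 (x : V) : (forall k, 0 <= slack_of k x) -> row_of ord0 x = 0 -> x = 0.
Proof. by move=> x0 r0; apply/ffunP => p; rewrite (eq0_of_row0 x0 r0) ffunE. Qed.

Lemma slack01 k (g : sheet n.+1) : (forall k, 0 <= slack k g) -> row_sum g ord0 = 1 ->
  slack k g = 0 \/ slack k g = 1.
Proof.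
move=> g0 g1; have := g0 k; have := slack_le_row0 g0 k; rewrite g1.
by move: (slack k g) => a /=; lia.
Qed.

Lemma HB_row_slack g : HB g -> (row_sum g ord0 = 1) * (forall k, 0 <= slack k g).
Proof. by move=> /irreducible_sheetP[/runner_up_consistentP g0 g1]; split. Qed.

Lemma HB_entry g : HB g -> exists p, g p = 1.
Proof.
move=> /HB_row_slack[g1 g0]; apply: contrapT => /forallNP none.
have : g = 0.
  apply/ffunP => p; rewrite ffunE.
  by have [//|/none] := slack01 (inl (inl p)) g0 g1.
by move=> gE; move: g1; rewrite gE row_sheet0.
Qed.

Lemma HB_list : exists2 E : seq V, uniq E & @embed R _ @` HB = [set` E].
Proof.
have /finite_seqP[s sE] : finite_set (@embed R _ @` HB).
  apply: finite_image; apply/finite_setP; eexists; exact: card_hilbert_basis.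
by exists (undup s); rewrite ?undup_uniq// sE; apply/seteqP; split=> x /=; rewrite mem_undup.
Qed.

(** Greedy decomposition with the sheets from [sheet_below]: the cone cut out by the slacks is
    spanned by the Hilbert basis. *)
Lemma slack_cone (E : seq V) (x : V) : uniq E -> @embed R _ @` HB = [set` E] ->
  (forall k, 0 <= slack_of k x) ->
  exists2 c : V -> R, forall v, 0 <= c v & x = \sum_(v <- E) c v *: v.
Proof.
move=> Eu EE; apply: (cone_decomposition (h := h)) => //= {}x x0 xN0.
have rN0 : row_of ord0 x != 0 by apply: contra_neq xN0; exact: space_eq0.
have [[|r] [[|q] [f [//= /andP[rq qn] ff fx]]]] := sheet_below x0 rN0.
have HBf : HB (sheet_of f).
  apply/irreducible_sheetP; split; last exact: (row0_sheet_of _ _ ff).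
  by apply/runner_up_consistentP; exact: (slack_sheet_of _ _ ff).
have [f1 f0] := HB_row_slack HBf.
exists (embed R (sheet_of f)); split=> [|k|k|].
- suff : [set` E] (embed R (sheet_of f)) by [].
  by rewrite -EE; exists (sheet_of f).
- by rewrite slack_embed; have [->|->] := slack01 k f0 f1; [left|right].
- by rewrite slack_embed ltr0z; exact: fx.
have [p fp] := HB_entry HBf; exists (inl (inl p)).
by rewrite slack_embed /= fp.
Qed.

Lemma cone_slack x : cone (@embed R _ @` M) x <-> forall k, 0 <= slack_of k x.
Proof.
split=> [[s [c [sM c0 ->]]] k|x0].
  rewrite linear_sum big_seq sumr_ge0// => v /sM[g /runner_up_consistentP g0 <-].
  by rewrite linearZ /= slack_embed mulr_ge0// ler0z.
have [E Eu EE] := HB_list; have [c c0 xE] := slack_cone Eu EE x0.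
exists E, c; split=> //; rewrite -EE => _ [g [Mg _ _] <-].
by exists g.
Qed.

Lemma conv_HB : conv (@embed R _ @` HB) = section_face lam h set0.
Proof.
apply/seteqP; split=> x.
  apply: conv_section_face => _ [g /HB_row_slack[g1 g0] <-].
  by split=> //= [|k]; rewrite ?row_embed ?g1// slack_embed ler0z.
move=> [/= x1 x0 _]; have [E Eu EE] := HB_list; have [c c0 xE] := slack_cone Eu EE x0.
exists E, c; split=> //; first by rewrite EE.
(* Every generator has first row sum 1, so the first row sum of [x] is the sum of the
   coefficients. *)
rewrite -x1 xE linear_sum; apply: eq_big_seq => v vE.
have [g /HB_row_slack[g1 _] <-] : (@embed R _ @` HB) v by rewrite EE.
by rewrite linearZ /= row_embed g1 mulr1.
Qed.

Lemma compressed_conv_HB : compressed (conv (@embed R _ @` HB)).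
Proof.
rewrite conv_HB; apply: section_face_compressed => [x [g _ <-]|k x [g _ <-]|k x [g _ <-] [/=]|].
- by exists (row_sum g ord0); rewrite /= row_embed.
- by exists (slack k g); rewrite /= slack_embed.
- rewrite row_embed => /(@intr_inj R _ 1) g1 g0 _.
  have {}g0 j : 0 <= slack j g by rewrite -(ler0z R) -slack_embed.
  by rewrite slack_embed; have [->|->] := slack01 k g0 g1; [left|right].
rewrite -conv_HB; have [E Eu EE] := HB_list; exists E; rewrite EE; split=> //.
by rewrite -EE => _ [g _ <-]; exists g.
Qed.

Lemma tight_sum_le0 g x : (forall k, 0 <= slack_of k x) -> tight_sum g x <= 0.
Proof. by move=> x0; rewrite oppr_le0 sumr_ge0. Qed.

(** Each slack vanishing on [g] vanishes on [x]. Hence [x] lives on the support of [g], which has at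
    most one entry per row, and all rows of [x] meeting this support have the same sum. *)
Lemma tight_sum_eq0 g x : HB g -> (forall k, 0 <= slack_of k x) ->
  tight_sum g x = 0 -> x = row_of ord0 x *: embed R g.
Proof.
move=> HBg x0 /eqP; rewrite oppr_eq0 psumr_eq0// => /allP tight0.
have {}tight0 k : slack k g = 0 -> slack_of k x = 0.
  by move=> /eqP gk; have := tight0 k (mem_index_enum k); rewrite gk => /eqP.
have entry0 i j : entry g i j = 0 -> entry (x : pairing n.+1 -> R) i j = 0.
  rewrite /entry; case: insubP => // p _ _ gp.
  exact: (tight0 (inl (inl p))).
move: HBg; rewrite hilbert_basisE => -[r [q [f [_ rq] [ff gE]]]].
apply/ffunP => p; rewrite !ffunE.
rewrite -(entry_pair (x : pairing n.+1 -> R)) -(entry_pair g).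
move: (val p).1 (val p).2 => i j; have := entry0 i j.
have entryE j' : entry g i j' = (f i == Some j')%:R by rewrite gE (entry_sheet_of _ ff).
rewrite entryE; case: eqP => [fi _|_ ->//]; last by rewrite scaler0.
have rowi : row_of i x = row_of ord0 x.
  apply/esym/eqP; rewrite -subr_eq0; apply/eqP.
  apply: (tight0 (inl (inr (ord0, i)))); rewrite /= gE.
  have iq : (i < q.+1)%N by rewrite -(scorers_isSome _ ff) ?fi.
  by rewrite !(row_sheet_of _ _ ff)// iq.
rewrite -rowi /row_of row_sumE (bigD1 j)//= big1 => [|k kj].
  by rewrite addr0 /GRing.scale /= mulr1.
apply: entry0; rewrite entryE fi; case: eqP => // -[jk].
by rewrite jk eqxx in kj.
Qed.

Lemma tight_sum_self g : tight_sum g (embed R g) = 0.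
Proof.
by rewrite /tight_sum big1 ?oppr0// => k /eqP gk; rewrite slack_embed gk.
Qed.

(** A vertex is a convex combination of generators, and one with nonzero weight lies on the face
    [[set v]], so it is [v]. Conversely, [tight_sum g] exposes each generator. *)
Lemma vertices_conv_HB : vertices (conv (@embed R _ @` HB)) = @embed R _ @` HB.
Proof.
apply/seteqP; split=> [v [l [b [lb vE]]]|_ [g HBg <-]].
  have : [set v] v by []; rewrite {1}vE => -[[s [c [sS c0 c1 vS]]] /= lv].
  have [w ws cw] : exists2 w, w \in s & c w != 0.
    apply: contrapT => /forall2NP none; have : (1 : R) != 0 by exact: oner_neq0.
    rewrite -c1 big_seq big1 ?eqxx// => w ws; apply/eqP/negPn/negP => cw.
    by case: (none w).
  have sP x : x \in s -> conv (@embed R _ @` HB) x.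
    move=> xs; exists [:: x], (fun=> 1); split=> //; rewrite ?big_seq1 ?scale1r//.
    by move=> y /=; rewrite inE => /eqP ->; exact: sS.
  have lw : l w = b.
    apply: (support_tight c0 _ _ ws cw) => [x /sP/lb//|].
    by rewrite -vS c1 mul1r.
  have : (conv (@embed R _ @` HB) `&` [set x | l x = b]) w by split=> //; exact: sP.
  by rewrite -vE => /= <-; exact: sS.
have [g1 g0] := HB_row_slack HBg.
exists (tight_sum g : {scalar V}), 0; rewrite conv_HB; split=> [x [_ x0 _]|].
  exact: tight_sum_le0.
apply/seteqP; split=> [_ ->|x [[/= x1 x0 _] lx]].
  split; last exact: tight_sum_self.
  by split=> //= [|k]; rewrite ?row_embed ?g1// slack_embed ler0z.
by rewrite /= [LHS](tight_sum_eq0 HBg x0 lx) x1 scale1r.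
Qed.

Lemma primitive_HB g : HB g -> primitive g.
Proof. by move=> /HB_entry[p gp] d /(_ p); rewrite gp. Qed.

Lemma extreme_integral_generators_HB :
  HB = extreme_integral_generators (cone (@embed R _ @` M)).
Proof.
apply/seteqP; split=> [g HBg|z [zprim [[l [b [lb FE]]] _]]].
  have [g1 g0] := HB_row_slack HBg.
  have eg0 k : 0 <= slack_of k (embed R g) by rewrite slack_embed ler0z.
  split; first exact: primitive_HB.
  split; last first.
    apply: has_dim_ray; apply/eqP => e0; have := row_embed ord0 g.
    by rewrite e0 linear0 g1 => /eqP; rewrite eq_sym oner_eq0.
  exists (tight_sum g : {scalar V}), 0; split=> [x /cone_slack|].
    exact: tight_sum_le0.
  apply/seteqP; split=> x.
    move=> /cone_set1[t t0 ->]; split; last first.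
      by rewrite /= linearZ /= tight_sum_self mulr0.
    by apply/cone_slack => k; rewrite linearZ /= mulr_ge0.
  move=> [/cone_slack x0 lx]; apply/cone_set1; exists (row_of ord0 x).
    exact: (row_ge0 x0 ord0).
  exact: tight_sum_eq0.
have zF : cone [set embed R z] (embed R z).
  by apply/cone_set1; exists 1; rewrite ?scale1r.
(* The ray contains the origin, where [l] is 0. *)
have b0 : b = 0.
  have : cone [set embed R z] 0 by apply/cone_set1; exists 0; rewrite ?scale0r.
  by rewrite FE => -[_ /=]; rewrite linear0.
move: (zF); rewrite FE => -[/cone_slack z0 /= lz].
have [E Eu EE] := HB_list; have [c c0 zE] := slack_cone Eu EE z0.
have zN0 : embed R z != 0.
  apply/eqP => e0; have z0E p : z p = 0.
    by have /eqP := congr1 (fun x : V => x p) e0; rewrite !ffunE intr_eq0 => /eqP.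
  (* If [z] were 0, then 0 would divide all its entries, and primitivity would make 0 divide 1. *)
  by have /zprim : forall p, (0 %| z p)%Z by move=> p; rewrite z0E.
have [w wE cw] : exists2 w, w \in E & c w != 0.
  apply: contrapT => /forall2NP none; move/eqP: zN0; apply.
  rewrite zE big_seq big1// => w wE; have [//|] := none w.
  by move=> /negP; rewrite negbK => /eqP ->; rewrite scale0r.
have EC v : v \in E -> cone (@embed R _ @` M) v.
  move=> vE; have [g /HB_row_slack[_ g0] <-] : (@embed R _ @` HB) v by rewrite EE.
  by apply/cone_slack => k; rewrite slack_embed ler0z.
have lw : l w = b.
  apply: (support_tight c0 _ _ wE cw) => [v /EC/lb//|].
  by rewrite -zE lz b0 mulr0.
have : (cone (@embed R _ @` M) `&` [set x | l x = b]) w by split=> //; exact: EC.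
rewrite -FE => /cone_set1[t t0 wt].
have [g HBg gw] : (@embed R _ @` HB) w by rewrite EE.
have gz p : (g p)%:~R = t * (z p)%:~R :> R.
  by have := congr1 (fun x : V => x p) wt; rewrite -gw !ffunE.
have [p gp] := HB_entry HBg.
have tz : t * (z p)%:~R = 1 by rewrite -gz gp.
(* At an entry with [g p = 1] the scalar [t] is the inverse of [z p], so [z] is [z p] times [g];
   primitivity and the sign then force [z p = 1]. *)
have zg i : z i = z p * g i.
  apply: (@intr_inj R); rewrite rmorphM /= gz mulrCA mulrA.
  by rewrite tz mul1r.
have : (z p %| 1)%Z by apply: zprim => i; rewrite [z i]zg dvdz_mulr.
rewrite dvdz1 => zp1.
have zp0 : 0 <= z p by have := z0 (inl (inl p)); rewrite slack_embed ler0z.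
have zp : z p = 1 by move: zp0 zp1; move: (z p) => a; lia.
suff -> : z = g by [].
by apply/ffunP => i; rewrite zg zp mul1r.
Qed.

End Geometry.

Theorem theorem4p1 (R : realType) (n : nat) (hn : (3 <= n)%N) :
  let M := runner_up_consistent n in
  let HB := hilbert_basis M in
  let C := cone (@embed R _ @` M) in
  let P := conv (@embed R _ @` HB) in
  [/\ minimal_generating_set M HB /\
      (forall G, minimal_generating_set M G -> G = HB),
      HB = sheets_A n `|` sheets_B n,
      HB = extreme_integral_generators C,
      vertices P = @embed R _ @` HB /\ compressed P
    & [/\ sheets_A n #= `I_((n - 1) * \sum_(0 <= i < n) (n - 2) ^ i)%N,
          sheets_B n #= `I_((n - 1) * \sum_(0 <= i < n) (n - 2) ^ i * (n - i - 1))%N,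
          HB #= `I_((n - 1) * \sum_(0 <= i < n) (n - 2) ^ i * (n - i))%N
        & ((n - 1) * \sum_(0 <= i < n) (n - 2) ^ i * (n - i) =
           (n - 1) * \sum_(0 <= k < n) \sum_(0 <= i < k.+1) (n - 2) ^ i)%N]].
Proof.
case: n hn => [//|n] _ M HB C P; split.
- exact: minimal_generating_hilbert_basis.
- exact: sheets_ABE.
- exact: extreme_integral_generators_HB.
- by split; [exact: vertices_conv_HB|exact: compressed_conv_HB].
split; [exact: card_sheets_A|exact: card_sheets_B|exact: card_hilbert_basis|].
by rewrite sum_expn_weighted.
Qed.
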